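(* Let $f_n:G\to\mathbf X_1$, $n\in\mathbb N$, be simple functions. If $(f_n)_n$ converges in $\mu$-measure to the zero function on every set $A\in\mathcal A$ with $\mu(A)\in\mathbf X_2$, and the integrals of the $f_n$ are $\mu$-equiabsolutely continuous, then $(f_n)_n$ converges in $L^1$ to $0$, that is, $\ell\big(\big(\int_G|f_n(g)|\,d\mu(g)\big)_n\big)=0$.
   Context: Conventions. All vector lattices are Dedekind complete. For such a lattice $Y$: $Y^+=\{y\in Y:y\ge 0\}$, $|y|=y\vee(-y)$, $\overline Y^+=Y^+\cup\{+\infty\}$ with order and operations extended in the natural way and $0\cdot(+\infty)=0$. An $(o)$-sequence in $Y$ is a decreasing sequence in $Y^+$ with infimum $0$. ''Definitely'' means for all but finitely many $n$. The supremum of an empty family of positive elements is $0$. Convergences. A convergence on $Y$ is a pair $(\mathcal S,\ell)$, where $\mathcal S$ is a linear subspace of the space of all sequences in $Y$ and $\ell:\mathcal S\to Y$ satisfies: (a) $\ell$ is linear; (b) if $(x_n),(y_n)\in\mathcal S$ and $x_n\le y_n$ definitely, then $\ell((x_n))\le\ell((y_n))$; (c) if $x_n=c$ definitely then $(x_n)\in\mathcal S$ and $\ell((x_n))=c$; if $(x_n)\in\mathcal S$ and $x_n\ne y_n$ for only finitely many $n$, then $(y_n)\in\mathcal S$ and $\ell((y_n))=\ell((x_n))$; (d) if $(x_n)\in\mathcal S$ then $(|x_n|)\in\mathcal S$ and $\ell((|x_n|))=|\ell((x_n))|$; (e) if $(x_n),(z_n)\in\mathcal S$, $\ell((x_n))=\ell((z_n))$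 and $x_n\le y_n\le z_n$ definitely, then $(y_n)\in\mathcal S$; (f) for $u\in Y^+$, $(\frac1n u)_n\in\mathcal S$ and $\ell((\frac1n u)_n)=0$. Writing $\ell((x_n)_n)=c$ means that $(x_n)_n$ is a sequence in $Y$ belonging to $\mathcal S$ and that the value of $\ell$ is $c$. Limit superior. Each convergence $(\mathcal S,\ell)$ comes with a map $\overline\ell$ from the set of sequences in $Y^+$ to $\overline Y^+$ such that: (a) $\overline\ell((x_n))=\overline\ell((y_n))$ if $x_n=y_n$ definitely; (b) $\overline\ell((x_n+y_n))\le\overline\ell((x_n))+\overline\ell((y_n))$; (c) if $x_n\le y_n$ definitely then $\overline\ell((x_n))\le\overline\ell((y_n))$; (d) $\overline\ell((x_n))=\ell((x_n))$ if $(x_n)\in\mathcal S$; (e) if $\overline\ell((x_n))=0$ then $(x_n)\in\mathcal S$ and $\ell((x_n))=0$. Product triples. $(Y_1,Y_2,Y)$, with convergences $\ell_1,\ell_2,\ell$ (and $\overline\ell_1,\overline\ell_2,\overline\ell$), is a product triple if there is a map $\cdot:Y_1\times Y_2\to Y$ with: (1),(2) additivity in each variable; (3) $x_1\ge y_1$ and $x_2\ge0$ imply $x_1\cdot x_2\ge y_1\cdot x_2$; (4) $x_1\ge0$ and $x_2\ge y_2$ imply $x_1\cdot x_2\ge x_1\cdot y_2$; (5) if $(x_n)$ is an $(o)$-sequence in $Y_1$ and $y\in Y_2^+$, then $(x_n\cdot y)$ is an $(o)$-sequence; (6) if $x\in Y_1^+$ and $(y_n)$ is an $(o)$-sequence in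 $Y_2$, then $(x\cdot y_n)$ is an $(o)$-sequence; (7) $\ell_1((x_n))=0$, $y\in Y_2$ imply $\ell((x_n\cdot y))=0$; (8) $x\in Y_1$, $\ell_2((y_n))=0$ imply $\ell((x\cdot y_n))=0$; (9) $x_n\in Y_1^+$, $\overline\ell_1((x_n))=x$, $y\in Y_2^+$ imply $\overline\ell((x_n\cdot y))=x\cdot y$; (10) $x\in Y_1^+$, $y_n\in Y_2^+$, $\overline\ell_2((y_n))=y$ imply $\overline\ell((x\cdot y_n))=x\cdot y$. $Y$ is a product algebra if $(Y,Y,Y)$ is a product triple. Setting. $(\mathbf X_1,\mathbf X_2,\mathbf X)$ is a product triple with convergences $\ell_1,\ell_2,\ell$; $\mathbf X_1,\mathbf X_2,\mathbf X$ are product algebras; $\mathbb R$ carries a convergence $\ell_{\mathbb R}$, and $(\mathbb R,\mathbf X,\mathbf X)$, $(\mathbb R,\mathbf X_j,\mathbf X_j)$ ($j=1,2$) are product triples. $G$ is a nonempty set, $\mathcal A$ an algebra of subsets of $G$, $\mu:\mathcal A\to\overline{\mathbf X}_2^+$ a finitely additive measure that is $\sigma$-finite: $G=\bigcup_n B_n$ for some $B_n\in\mathcal A$ with $\mu(B_n)\in\mathbf X_2^+$. Simple functions. $f:G\to\mathbf X_1$ is simple if $f=\sum_{j=1}^r c_j\chi_{A_j}$ with $c_j\in\mathbf X_1$, $A_j\in\mathcal A$, $\mu(A_j)\in\mathbf X_2^+$; then $\int_A f\,d\mu=\sum_j c_j\cdot\mu(A\cap A_j)$ for $A\in\mathcal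 A$ (independent of the representation). Convergence in measure. $(f_n)_n$ converges in $\mu$-measure to $f$ on $A\in\mathcal A$ if there is a sequence $(A_n)_n$ in $\mathcal A$ with $\ell_2((\mu(A\cap A_n))_n)=0$ and $\ell_1\big(\big(\bigvee_{g\in A\setminus A_n}|f_n(g)-f(g)|\big)_n\big)=0$. Equiabsolute continuity. The integrals of a sequence $(f_n)_n$ of simple functions are $\mu$-equiabsolutely continuous if: (i) $\ell\big(\big(\int_{A_n}|f_n|\,d\mu\big)_n\big)=0$ for every sequence $(A_n)_n$ in $\mathcal A$ with $\ell_2((\mu(A_n))_n)=0$; (ii) there is an increasing sequence $(B_m)_m$ in $\mathcal A$ with $\mu(B_m)\in\mathbf X_2$ for all $m$ and $\ell\Big(\Big(\overline\ell\Big(\Big(\int_{G\setminus B_m}|f_n|\,d\mu\Big)_n\Big)\Big)_m\Big)=0$. *)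

(* Defs.v *)
From HB Require Import structures.
From mathcomp Require Import all_boot all_order all_algebra.
From mathcomp Require Import all_classical all_reals all_analysis.

Set Implicit Arguments.
Unset Strict Implicit.
Unset Printing Implicit Defensive.

Import Order.TTheory GRing.Theory Num.Theory.

Local Open Scope classical_set_scope.
Local Open Scope ring_scope.

(* The lattice operations are not taken from Order.Lattice because Hierarchy
   Builder does not allow a new join of Order.Lattice and GRing.Zmodule once
   Num.RealDomain has been declared. *)
HB.mixin Record isDedekindVectorLattice (R : realType) Y
    & GRing.Lmodule R Y & Num.POrderedZmodule Y := {
  vjoin : Y -> Y -> Y ;
  vmeet : Y -> Y -> Y ;
  vjoin_le : forall x y z : Y, (vjoin x y <= z) = (x <= z) && (y <= z) ;
  le_vmeet : forall x y z : Y, (z <= vmeet x y) = (z <= x) && (z <= y) ;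
  vleD2r : forall z x y : Y, x <= y -> x + z <= y + z ;
  vleZ : forall (a : R) (x y : Y), 0 <= a -> x <= y -> a *: x <= a *: y ;
  vdedekind : forall A : set Y, has_sup A -> supremums A !=set0
}.

#[short(type="vectorLatticeType")]
HB.structure Definition DedekindVectorLattice (R : realType) :=
  {Y of GRing.Lmodule R Y & Num.POrderedZmodule Y
      & isDedekindVectorLattice R Y}.

Section RealLine.
Variable R : realType.

Let r_join_le (x y z : R) : (Num.max x y <= z) = (x <= z) && (y <= z).
Proof. exact: ge_max. Qed.

Let r_le_meet (x y z : R) : (z <= Num.min x y) = (z <= x) && (z <= y).
Proof. exact: le_min. Qed.

Let r_leD2r (z x y : R) : x <= y -> x + z <= y + z.
Proof. by rewrite lerD2r. Qed.

Let r_leZ (a : R) (x y : R^o) :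
  0 <= a -> (x : R) <= y -> (a *: x : R) <= a *: y.
Proof. by move=> a0 xy; exact: (ler_wpM2l a0 xy). Qed.

Let r_dedekind (A : set R) : has_sup A -> supremums A !=set0.
Proof.
move=> [A0 Aub]; exists (sup A); split.
  by move=> x Ax; exact: ub_le_sup.
by move=> y Ay; exact: ge_sup.
Qed.

HB.instance Definition _ := Num.POrderedZmodule.copy R^o R.
HB.instance Definition _ := isDedekindVectorLattice.Build R R^o
  r_join_le r_le_meet r_leD2r r_leZ r_dedekind.

End RealLine.

Definition vabs (R : realType) (Y : vectorLatticeType R) (y : Y) : Y :=
  vjoin y (- y).

(* Unlike [supremum 0 A], the relation [is_sup0 A s] fails when [A] is nonempty
   and has no supremum. *)
Definition is_sup0 (R : realType) (Y : vectorLatticeType R)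
    (A : set Y) (s : Y) : Prop :=
  (A = set0 -> s = 0) /\ (A !=set0 -> supremums A s).

Definition o_sequence (R : realType) (Y : vectorLatticeType R)
    (x : nat -> Y) : Prop :=
  [/\ forall n, 0 <= x n, forall n, x n.+1 <= x n & infimums (range x) 0].

(* [ext Y] is Y with a point +oo adjoined; the set of positive elements of Y
   together with +oo is [[set x : ext Y | ext_ge0 x]]. *)
Variant ext (Y : Type) : Type := Fin of Y | Inf.
Arguments Fin {Y} _.
Arguments Inf {Y}.

Definition is_fin (Y : Type) (x : ext Y) : Prop := exists y, x = Fin y.

Definition ext_ge0 (R : realType) (Y : vectorLatticeType R) (x : ext Y) : Prop :=
  if x is Fin y then 0 <= y else True.

Definition ext_le (R : realType) (Y : vectorLatticeType R)
    (x y : ext Y) : Prop :=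
  match x, y with
  | _, Inf => True
  | Fin a, Fin b => a <= b
  | Inf, Fin _ => False
  end.

Definition ext_add (R : realType) (Y : vectorLatticeType R)
    (x y : ext Y) : ext Y :=
  if x is Fin a then if y is Fin b then Fin (a + b) else Inf else Inf.

Definition ext_mul (R : realType) (Y1 Y2 Y : vectorLatticeType R)
    (mul : Y1 -> Y2 -> Y) (x : ext Y1) (y : ext Y2) : ext Y :=
  match x, y with
  | Fin a, Fin b => Fin (mul a b)
  | Fin a, Inf => if a == 0 then Fin 0 else Inf
  | Inf, Fin b => if b == 0 then Fin 0 else Inf
  | Inf, Inf => Inf
  end.

Definition ext_fine (R : realType) (Y : vectorLatticeType R) (x : ext Y) : Y :=
  if x is Fin y then y else 0.

(* [clim] is meaningful on [cdom] only, and [climsup] on sequences of positive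
   elements only. Sequences are indexed from 0, hence [n.+1] in [clim_harmonic]. *)
Record convergence (R : realType) (Y : vectorLatticeType R) := Convergence {
  cdom : set (nat -> Y) ;
  clim : (nat -> Y) -> Y ;
  climsup : (nat -> Y) -> ext Y ;
  cdom_linear : forall (a : R) (x y : nat -> Y), cdom x -> cdom y ->
    cdom (fun n => a *: x n + y n) ;
  clim_linear : forall (a : R) (x y : nat -> Y), cdom x -> cdom y ->
    clim (fun n => a *: x n + y n) = a *: clim x + clim y ;
  clim_le : forall x y : nat -> Y, cdom x -> cdom y ->
    (\forall n \near \oo, x n <= y n) -> clim x <= clim y ;
  clim_cst : forall (x : nat -> Y) (c : Y),
    (\forall n \near \oo, x n = c) -> cdom x /\ clim x = c ;
  clim_near : forall x y : nat -> Y, cdom x ->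
    (\forall n \near \oo, x n = y n) -> cdom y /\ clim y = clim x ;
  clim_abs : forall x : nat -> Y, cdom x ->
    cdom (fun n => vabs (x n)) /\ clim (fun n => vabs (x n)) = vabs (clim x) ;
  cdom_squeeze : forall x y z : nat -> Y, cdom x -> cdom z ->
    clim x = clim z -> (\forall n \near \oo, x n <= y n /\ y n <= z n) ->
    cdom y ;
  clim_harmonic : forall u : Y, 0 <= u ->
    cdom (fun n => (n.+1%:R^-1 : R) *: u) /\
    clim (fun n => (n.+1%:R^-1 : R) *: u) = 0 ;
  climsup_ge0 : forall x : nat -> Y, (forall n, 0 <= x n) ->
    ext_ge0 (climsup x) ;
  climsup_near : forall x y : nat -> Y,
    (forall n, 0 <= x n) -> (forall n, 0 <= y n) ->
    (\forall n \near \oo, x n = y n) -> climsup x = climsup y ;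
  climsup_add : forall x y : nat -> Y,
    (forall n, 0 <= x n) -> (forall n, 0 <= y n) ->
    ext_le (climsup (fun n => x n + y n)) (ext_add (climsup x) (climsup y)) ;
  climsup_le : forall x y : nat -> Y,
    (forall n, 0 <= x n) -> (forall n, 0 <= y n) ->
    (\forall n \near \oo, x n <= y n) -> ext_le (climsup x) (climsup y) ;
  climsup_clim : forall x : nat -> Y, (forall n, 0 <= x n) -> cdom x ->
    climsup x = Fin (clim x) ;
  climsup_eq0 : forall x : nat -> Y, (forall n, 0 <= x n) ->
    climsup x = Fin 0 -> cdom x /\ clim x = 0
}.

Definition lim_eq (R : realType) (Y : vectorLatticeType R)
    (l : convergence Y) (x : nat -> Y) (c : Y) : Prop :=
  cdom l x /\ clim l x = c.

(* A sequence with values in [ext Y] has a limit only if all its terms lie in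
   [Y]. *)
Definition ext_lim_eq (R : realType) (Y : vectorLatticeType R)
    (l : convergence Y) (x : nat -> ext Y) (c : Y) : Prop :=
  exists y : nat -> Y, (forall n, x n = Fin (y n)) /\ lim_eq l y c.

Record product_map (R : realType) (Y1 Y2 Y : vectorLatticeType R)
    (l1 : convergence Y1) (l2 : convergence Y2) (l : convergence Y)
    (mul : Y1 -> Y2 -> Y) : Prop := {
  pmulDl : forall x1 y1 x2, mul (x1 + y1) x2 = mul x1 x2 + mul y1 x2 ;
  pmulDr : forall x1 x2 y2, mul x1 (x2 + y2) = mul x1 x2 + mul x1 y2 ;
  pmul_le2r : forall x1 y1 x2, y1 <= x1 -> 0 <= x2 -> mul y1 x2 <= mul x1 x2 ;
  pmul_le2l : forall x1 x2 y2, 0 <= x1 -> y2 <= x2 -> mul x1 y2 <= mul x1 x2 ;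
  pmul_ol : forall (x : nat -> Y1) (y : Y2), o_sequence x -> 0 <= y ->
    o_sequence (fun n => mul (x n) y) ;
  pmul_or : forall (x : Y1) (y : nat -> Y2), 0 <= x -> o_sequence y ->
    o_sequence (fun n => mul x (y n)) ;
  pmul_lim0l : forall (x : nat -> Y1) (y : Y2), lim_eq l1 x 0 ->
    lim_eq l (fun n => mul (x n) y) 0 ;
  pmul_lim0r : forall (x : Y1) (y : nat -> Y2), lim_eq l2 y 0 ->
    lim_eq l (fun n => mul x (y n)) 0 ;
  pmul_limsupl : forall (x : nat -> Y1) (y : Y2),
    (forall n, 0 <= x n) -> 0 <= y ->
    climsup l (fun n => mul (x n) y) = ext_mul mul (climsup l1 x) (Fin y) ;
  pmul_limsupr : forall (x : Y1) (y : nat -> Y2),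
    0 <= x -> (forall n, 0 <= y n) ->
    climsup l (fun n => mul x (y n)) = ext_mul mul (Fin x) (climsup l2 y)
}.

Definition product_triple (R : realType) (Y1 Y2 Y : vectorLatticeType R)
    (l1 : convergence Y1) (l2 : convergence Y2) (l : convergence Y) : Prop :=
  exists mul : Y1 -> Y2 -> Y, product_map l1 l2 l mul.

Definition product_algebra (R : realType) (Y : vectorLatticeType R)
    (l : convergence Y) : Prop := product_triple l l l.

(* The algebra of sets is [measurable]; the values of [mu] outside of it are
   irrelevant. *)
Record finitely_additive_measure (R : realType) (d : measure_display)
    (G : algebraOfSetsType d) (Y : vectorLatticeType R)
    (mu : set G -> ext Y) : Prop := {
  fam_ge0 : forall A, measurable A -> ext_ge0 (mu A) ;
  fam0 : mu set0 = Fin 0 ;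
  famU : forall A B, measurable A -> measurable B -> A `&` B = set0 ->
    mu (A `|` B) = ext_add (mu A) (mu B)
}.

Definition fam_sigma_finite (R : realType) (d : measure_display)
    (G : algebraOfSetsType d) (Y : vectorLatticeType R)
    (mu : set G -> ext Y) : Prop :=
  exists B : nat -> set G,
    (forall n, measurable (B n) /\ is_fin (mu (B n))) /\
    \bigcup_n B n = [set: G].

Section Integral.
Variables (R : realType) (X1 X2 X : vectorLatticeType R) (mul : X1 -> X2 -> X).
Variables (d : measure_display) (G : algebraOfSetsType d) (mu : set G -> ext X2).

Definition cindic (c : X1) (A : set G) (g : G) : X1 :=
  if g \in A then c else 0.

(* A list of pairs (c_j, A_j), where the A_j need not be disjoint. *)
Definition simple_repr (f : G -> X1) (s : seq (X1 * set G)) : Prop :=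
  (forall p, p \in s -> measurable p.2 /\ is_fin (mu p.2)) /\
  forall g, f g = \sum_(p <- s) cindic p.1 p.2 g.

Definition vsimple (f : G -> X1) : Prop := exists s, simple_repr f s.

Definition repr_integral (s : seq (X1 * set G)) (A : set G) : X :=
  \sum_(p <- s) mul p.1 (ext_fine (mu (A `&` p.2))).

(* The value for some representation of [f] (all of them give the same one when
   [mul] is biadditive and [mu] is finitely additive); 0 if [f] is not simple. *)
Definition vintegral (A : set G) (f : G -> X1) : X :=
  xget 0 [set repr_integral s A | s in [set s | simple_repr f s]].

Variables (l1 : convergence X1) (l2 : convergence X2) (l : convergence X).

Definition cvg_in_measure (f : nat -> G -> X1) (h : G -> X1)
    (A : set G) : Prop :=
  exists (E : nat -> set G) (u : nat -> X1),
    [/\ forall n, measurable (E n),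
        ext_lim_eq l2 (fun n => mu (A `&` E n)) 0,
        forall n, is_sup0 [set vabs (f n g - h g) | g in A `\` E n] (u n) &
        lim_eq l1 u 0].

Definition equiabsolutely_continuous (f : nat -> G -> X1) : Prop :=
  (forall A : nat -> set G, (forall n, measurable (A n)) ->
    ext_lim_eq l2 (fun n => mu (A n)) 0 ->
    lim_eq l (fun n => vintegral (A n) (fun g => vabs (f n g))) 0) /\
  (exists B : nat -> set G,
    [/\ forall m, measurable (B m),
        forall m, B m `<=` B m.+1,
        forall m, is_fin (mu (B m)) &
        ext_lim_eq l (fun m => climsup l (fun n =>
          vintegral (~` B m) (fun g => vabs (f n g)))) 0]).

End Integral.

(* Main.v *)
(* Given m, split G into B_m and its complement, and B_m into the exceptional
   set E_n of the convergence in measure and the rest, where |f_n| <= u_n.  Then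
     \int_G |f_n| <= \int_{B_m \cap E_n} |f_n| + u_n mu(B_m)
                     + \int_{G \ B_m} |f_n|;
   the first two terms tend to 0, so the limit superior of the left-hand side is
   at most that of the third term, which tends to 0 as m grows. *)
Require Import Defs.
From mathcomp Require Import all_boot all_order all_algebra.
From mathcomp Require Import all_classical all_reals all_analysis.

Import Order.TTheory GRing.Theory Num.Theory.

Local Open Scope classical_set_scope.
Local Open Scope ring_scope.

(** * Order and absolute value in a vector lattice *)

Section VectorLattice.
Context {R : realType} {Y : vectorLatticeType R}.
Implicit Types x y z : Y.

Lemma vleD x y z t : x <= y -> z <= t -> x + z <= y + t.
Proof.
move=> xy zt; apply: (le_trans (vleD2r z _ _ xy)).
by rewrite ![y + _]addrC; exact: vleD2r.
Qed.

Lemma vaddr_ge0 x y : 0 <= x -> 0 <= y -> 0 <= x + y.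
Proof. by move=> x0 y0; rewrite -[0]addr0; exact: vleD. Qed.

Lemma vsubr_ge0 x y : 0 <= y - x -> x <= y.
Proof. by move=> /(vleD2r x); rewrite add0r subrK. Qed.

(** Adding [x <= vabs x] and [- x <= vabs x] gives 0 <= 2 |x|; scaling by 1/2 removes the factor. *)
Lemma vabs_ge0 x : 0 <= vabs x.
Proof.
have := lexx (vabs x); rewrite {1}/vabs vjoin_le => /andP[xx Nxx].
have := vleD _ _ _ _ xx Nxx; rewrite subrr -mulr2n -scaler_nat => h.
have h2 : (0 : R) <= 2^-1 by rewrite invr_ge0 ler0n.
have := vleZ _ _ _ h2 h.
by rewrite scaler0 scalerA mulVf ?scale1r// pnatr_eq0.
Qed.

Lemma vabs0 : vabs (0 : Y) = 0.
Proof.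
apply/le_anti; rewrite vabs_ge0 andbT.
by rewrite /vabs vjoin_le oppr0 lexx.
Qed.

End VectorLattice.

(** * Estimates for the limit superior *)

Section ExtendedLattice.
Context {R : realType} {Y : vectorLatticeType R}.

Lemma ext_le_trans {x y z : ext Y} : ext_le x y -> ext_le y z -> ext_le x z.
Proof. by case: x y z => [a|] [b|] [c|]//=; exact: le_trans. Qed.

Lemma climsup_add_null (l : convergence Y) (a y : nat -> Y) :
  (forall n, 0 <= a n) -> (forall n, 0 <= y n) -> lim_eq l a 0 ->
  ext_le (climsup l (fun n => a n + y n)) (climsup l y).
Proof.
move=> a0 y0 [da la]; have := climsup_add l a0 y0.
rewrite (climsup_clim a0 da) la.
by case: (climsup l y) => //= b; rewrite add0r.
Qed.

(** The bound by [y 0] makes the limit superior a finite [c]. Comparing the constant sequence [c]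
    with [y] in the limit gives [c <= 0], and a zero limit superior forces convergence to 0. *)
Lemma climsup_squeeze0 (l : convergence Y) (x y : nat -> Y) :
  (forall n, 0 <= x n) -> lim_eq l y 0 ->
  (forall m, ext_le (climsup l x) (Fin (y m))) -> lim_eq l x 0.
Proof.
move=> x0 [dy ly] xy; apply: climsup_eq0 => //.
move: (climsup_ge0 l x0) xy; case: (climsup l x) => [c|]//= c0 cy; last first.
  by case: (cy 0).
have [dc lc] : cdom l (fun=> c) /\ clim l (fun=> c) = c.
  by apply: clim_cst; exact: nearW.
congr Fin; apply/le_anti; rewrite c0 andbT -{1}lc -ly.
by apply: clim_le => //; exact: nearW.
Qed.

End ExtendedLattice.

(** * Signs of products and splitting of the measure *)

Section Integral.
Context {R : realType} {X1 X2 X : vectorLatticeType R}.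
Context {l1 : convergence X1} {l2 : convergence X2} {l : convergence X}.
Context {mul : X1 -> X2 -> X} (hmul : product_map l1 l2 l mul).
Context {d : measure_display} {G : algebraOfSetsType d} {mu : set G -> ext X2}.
Context (hmu : finitely_additive_measure mu).

Lemma pmul0l y : mul 0 y = 0.
Proof. by apply: (addIr (mul 0 y)); rewrite -(pmulDl hmul) !add0r. Qed.

Lemma pmul0r x : mul x 0 = 0.
Proof. by apply: (addIr (mul x 0)); rewrite -(pmulDr hmul) !add0r. Qed.

Lemma pmulNl x y : mul (- x) y = - mul x y.
Proof. by apply: (addIr (mul x y)); rewrite -(pmulDl hmul) !addNr pmul0l. Qed.

Lemma pmul_ge0 x y : 0 <= x -> 0 <= y -> 0 <= mul x y.
Proof. by move=> x0 y0; rewrite -(pmul0l y); exact: (pmul_le2r hmul). Qed.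

Definition fin_measurable (A : set G) := measurable A /\ is_fin (mu A).

Lemma fam_split {A C : set G} : measurable A -> measurable C ->
  mu A = ext_add (mu (A `&` C)) (mu (A `\` C)).
Proof.
move=> mA mC; rewrite -(famU hmu) ?setUIDK//; first exact: measurableI.
  exact: measurableD.
by apply/seteqP; split=> x //= [[_ Cx] [_ /(_ Cx)]].
Qed.

Lemma fin_measurableI {A C : set G} :
  fin_measurable A -> measurable C -> fin_measurable (A `&` C).
Proof.
move=> [mA [a muA]] mC; split; first exact: measurableI.
move: (fam_split mA mC); rewrite muA.
by case: (mu (A `&` C)) => [b|]//= _; exists b.
Qed.

Lemma fin_measurableD {A C : set G} :
  fin_measurable A -> measurable C -> fin_measurable (A `\` C).
Proof. by move=> fA mC; apply: fin_measurableI => //; exact: measurableC. Qed.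

Lemma fine_fam_split {A C : set G} : fin_measurable A -> measurable C ->
  ext_fine (mu A) = ext_fine (mu (A `&` C)) + ext_fine (mu (A `\` C)).
Proof.
move=> fA mC; have [_ [b Eb]] := fin_measurableI fA mC.
have [_ [c Ec]] := fin_measurableD fA mC.
by rewrite (fam_split fA.1 mC) Eb Ec.
Qed.

Lemma fine_fam_ge0 (A : set G) : measurable A -> 0 <= ext_fine (mu A).
Proof. by move=> /(fam_ge0 hmu); case: (mu A) => //=. Qed.

(** * Integrals of representations *)

Definition fin_repr (s : seq (X1 * set G)) :=
  forall p, p \in s -> fin_measurable p.2.

Lemma fin_repr_cons p s : fin_repr (p :: s) -> fin_measurable p.2 /\ fin_repr s.
Proof.
move=> ps; split=> [|q qs]; apply: ps; rewrite inE ?eqxx//.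
by rewrite qs orbT.
Qed.

Lemma fin_repr_cat s t : fin_repr s -> fin_repr t -> fin_repr (s ++ t).
Proof. by move=> fs ft p; rewrite mem_cat => /orP[/fs|/ft]. Qed.

Definition repr_opp (s : seq (X1 * set G)) := [seq (- p.1, p.2) | p <- s].

Lemma fin_repr_opp s : fin_repr s -> fin_repr (repr_opp s).
Proof. by move=> fs p /mapP[q /fs ? ->]. Qed.

Lemma repr_opp_fun s g : \sum_(p <- repr_opp s) cindic p.1 p.2 g =
  - \sum_(p <- s) cindic p.1 p.2 g.
Proof.
rewrite big_map -sumrN; apply: eq_bigr => p _ /=.
by rewrite /cindic; case: ifP; rewrite ?oppr0.
Qed.

Lemma repr_integral_opp s A :
  repr_integral mul mu (repr_opp s) A = - repr_integral mul mu s A.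
Proof.
rewrite /repr_integral big_map -sumrN; apply: eq_bigr => p _ /=.
exact: pmulNl.
Qed.

Lemma repr_integral_cat s t A : repr_integral mul mu (s ++ t) A =
  repr_integral mul mu s A + repr_integral mul mu t A.
Proof. by rewrite /repr_integral big_cat. Qed.

(** [A] may have infinite measure, as G itself may: each term only measures the part of [A] inside a
    set of finite measure, and that part is split by [C]. *)
Lemma repr_integral_split {s A C} : fin_repr s -> measurable A ->
  measurable C -> repr_integral mul mu s A =
  repr_integral mul mu s (A `&` C) + repr_integral mul mu s (A `\` C).
Proof.
move=> fs mA mC; rewrite /repr_integral -big_split big_seq [RHS]big_seq.
apply: eq_bigr => p /fs fp /=; rewrite -(pmulDr hmul).
rewrite setIC (fine_fam_split (fin_measurableI fp mA) mC).
by rewrite !setDE -!setIA ![p.2 `&` _]setIC !setIA.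
Qed.

(** The sets of a representation may overlap. Instead of making them disjoint, the induction
    accumulates in [c] the coefficients already met: for a first pair [(b, C)] the constant becomes
    [c + b] on the part of [A] inside [C] and stays [c] outside. *)
Lemma repr_integral_affine_ge0 s c A : fin_repr s -> fin_measurable A ->
  (forall g, A g -> 0 <= c + \sum_(p <- s) cindic p.1 p.2 g) ->
  0 <= mul c (ext_fine (mu A)) + repr_integral mul mu s A.
Proof.
elim: s c A => [|[b C] s IH] c A fs fA h.
  rewrite /repr_integral big_nil addr0.
  (* The sign of [c] is known only if [A] has a point; an empty [A] has measure 0. *)
  have [A0|[g Ag]] : A = set0 \/ A !=set0.
  - by case: (eqVneq A set0) => [|/set0P]; [left|right].
  - by rewrite A0 (fam0 hmu) /= pmul0r.
  - apply: pmul_ge0; last exact: fine_fam_ge0 fA.1.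
    by move: (h _ Ag); rewrite big_nil addr0.
have [/= fC {}fs] := fin_repr_cons _ _ fs.
rewrite (fine_fam_split fA fC.1) /repr_integral big_cons /=.
rewrite -/(repr_integral mul mu s A) (repr_integral_split fs fA.1 fC.1).
(* The five terms are regrouped into those over the part of [A] inside [C], where [c] and [b] merge,
   and those outside. *)
rewrite (pmulDr hmul) (AC (2*(1*2)) ((1*3*4)*(2*5)))/= -(pmulDl hmul).
apply: vaddr_ge0; apply: IH => //; first exact: fin_measurableI fA fC.1.
- move=> g [Ag Cg]; have := h _ Ag.
  by rewrite big_cons /= {1}/cindic mem_set// addrA.
- exact: fin_measurableD fA fC.1.
- move=> g [Ag nCg]; have := h _ Ag.
  by rewrite big_cons /= {1}/cindic memNset// add0r.
Qed.

(** On a set of infinite measure no constant can be carried along. The part of [A] inside the first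
    set [C] has finite measure and falls under the affine case with constant [b]; outside [C] the
    first pair vanishes and induction applies. *)
Lemma repr_integral_ge0 s A : fin_repr s -> measurable A ->
  (forall g, A g -> 0 <= \sum_(p <- s) cindic p.1 p.2 g) ->
  0 <= repr_integral mul mu s A.
Proof.
elim: s A => [|[b C] s IH] A fs mA h; first by rewrite /repr_integral big_nil.
have [/= fC {}fs] := fin_repr_cons _ _ fs.
rewrite /repr_integral big_cons /= -/(repr_integral mul mu s A).
rewrite (repr_integral_split fs mA fC.1) addrA.
apply: vaddr_ge0; [apply: repr_integral_affine_ge0|apply: IH] => //.
- by rewrite setIC; exact: fin_measurableI.
- move=> g [Ag Cg]; have := h _ Ag.
  by rewrite big_cons /= {1}/cindic mem_set.
- by apply: measurableD => //; exact: fC.1.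
- move=> g [Ag nCg]; have := h _ Ag.
  by rewrite big_cons /= {1}/cindic memNset// add0r.
Qed.

Lemma repr_integral_le s t A : fin_repr s -> fin_repr t -> measurable A ->
  (forall g, A g ->
    \sum_(p <- s) cindic p.1 p.2 g <= \sum_(p <- t) cindic p.1 p.2 g) ->
  repr_integral mul mu s A <= repr_integral mul mu t A.
Proof.
move=> fs ft mA st; apply: vsubr_ge0.
rewrite -repr_integral_opp -repr_integral_cat.
apply: repr_integral_ge0 => //.
  by apply: fin_repr_cat => //; exact: fin_repr_opp.
move=> g /st /(vleD2r (- \sum_(p <- s) cindic p.1 p.2 g)).
by rewrite subrr big_cat /= repr_opp_fun.
Qed.

(** Two representations of one function dominate each other, so monotonicity in both directions
    identifies their integrals. The default value of [xget] is excluded because [s] is itself a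
    witness. *)
Lemma vintegralE {f s A} : simple_repr mu f s -> measurable A ->
  vintegral mul mu A f = repr_integral mul mu s A.
Proof.
move=> [fs sE] mA; rewrite /vintegral; case: xgetP => [_ _ [t [ft tE] <-]|].
  by apply/le_anti/andP; split; apply: repr_integral_le => // g _;
    rewrite -sE -tE.
by move=> /(_ (repr_integral mul mu s A))/forall2NP/(_ s)[]; case.
Qed.

Lemma vintegral_ge0 f A : vsimple mu f -> measurable A ->
  (forall g, A g -> 0 <= f g) -> 0 <= vintegral mul mu A f.
Proof.
move=> [s fs] mA f0; rewrite (vintegralE fs mA).
by apply: repr_integral_ge0 => //; [exact: fs.1|move=> g /f0; rewrite fs.2].
Qed.

Lemma vintegral_split {f A} C : vsimple mu f -> measurable A -> measurable C ->
  vintegral mul mu A f =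
  vintegral mul mu (A `&` C) f + vintegral mul mu (A `\` C) f.
Proof.
move=> [s fs] mA mC; rewrite !(vintegralE fs)//.
- by apply: repr_integral_split => //; exact: fs.1.
- exact: measurableD.
- exact: measurableI.
Qed.

Lemma vintegral_le_cst f A c : vsimple mu f -> fin_measurable A ->
  (forall g, A g -> f g <= c) ->
  vintegral mul mu A f <= mul c (ext_fine (mu A)).
Proof.
move=> [s fs] fA fc; rewrite (vintegralE fs fA.1).
have -> : mul c (ext_fine (mu A)) = repr_integral mul mu [:: (c, A)] A.
  by rewrite /repr_integral big_seq1 /= setIid.
apply: repr_integral_le; [exact: fs.1| |exact: fA.1|].
  by move=> p; rewrite inE => /eqP ->.
move=> g Ag; rewrite big_seq1 -fs.2 /= /cindic mem_set//.
exact: fc.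
Qed.

(** * Stability of simple functions, needed for |f_n| *)

Lemma vsimpleD (f h : G -> X1) : vsimple mu f -> vsimple mu h ->
  vsimple mu (fun g => f g + h g).
Proof.
move=> [s [fs sE]] [t [ft tE]]; exists (s ++ t); split.
  exact: fin_repr_cat.
by move=> g; rewrite big_cat sE tE.
Qed.

Lemma vsimple_restrict (f : G -> X1) C : vsimple mu f -> measurable C ->
  vsimple mu (fun g => cindic (f g) C g).
Proof.
move=> [s [fs sE]] mC; exists [seq (p.1, p.2 `&` C) | p <- s]; split.
  by move=> p /mapP[q /fs fq ->]; exact: fin_measurableI.
move=> g; rewrite big_map /cindic sE; case: ifPn => [Cg|nCg].
  by apply: eq_bigr => p _ /=; rewrite in_setI Cg andbT.
by rewrite big1// => p _; rewrite /= in_setI (negbTE nCg) andbF.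
Qed.

(* In the induction step h (c 1_C + f) is (h (c + f) - h c) on C plus h c 1_C
   plus h f off C, and x |-> h (c + x) - h c again vanishes at 0. *)
Lemma vsimple_comp (h : X1 -> X1) f : h 0 = 0 -> vsimple mu f ->
  vsimple mu (fun g => h (f g)).
Proof.
move=> h0 [s [fs sE]].
have -> : f = fun g => \sum_(p <- s) cindic p.1 p.2 g by apply/funext.
elim: s {sE f} h h0 fs => [|[c C] s IH] h h0 fs.
  by exists [::]; split => // g; rewrite !big_nil.
have [/= fC {}fs] := fin_repr_cons _ _ fs.
pose k x := h (c + x) - h c.
have sk : vsimple mu (fun g => k (\sum_(p <- s) cindic p.1 p.2 g)).
  by apply: IH => //; rewrite /k addr0 subrr.
have sc : vsimple mu (fun g => cindic (h c) C g).
  exists [:: (h c, C)]; split; first by move=> p; rewrite inE => /eqP ->.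
  by move=> g; rewrite big_seq1.
have := vsimpleD _ _ (vsimpleD _ _ (vsimple_restrict _ C sk fC.1) sc)
  (vsimple_restrict _ (~` C) (IH h h0 fs) (measurableC fC.1)).
congr (vsimple _ _); apply/funext => g.
rewrite big_cons /= /cindic in_setC; case: (g \in C) => /=.
  by rewrite /k subrK addr0.
by rewrite !add0r.
Qed.

End Integral.

Theorem theorem3p6 (R : realType) (X1 X2 X : vectorLatticeType R)
  (l1 : convergence X1) (l2 : convergence X2) (l : convergence X)
  (lR : convergence (R^o : vectorLatticeType R))
  (mul : X1 -> X2 -> X) (hmul : product_map l1 l2 l mul)
  (hX1 : product_algebra l1) (hX2 : product_algebra l2)
  (hX : product_algebra l)
  (hRX : product_triple lR l l)
  (hRX1 : product_triple lR l1 l1) (hRX2 : product_triple lR l2 l2)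
  (d : measure_display) (G : algebraOfSetsType d) (mu : set G -> ext X2)
  (hmu : finitely_additive_measure mu) (hsigma : fam_sigma_finite mu)
  (f : nat -> G -> X1) (hf : forall n, vsimple mu (f n))
  (hcvg : forall A : set G, measurable A -> is_fin (mu A) ->
    cvg_in_measure mu l1 l2 f (fun _ => 0) A)
  (heq : equiabsolutely_continuous mul mu l2 l f) :
  lim_eq l (fun n => vintegral mul mu [set: G] (fun g => vabs (f n g))) 0.
Proof.
have habs n : vsimple mu (fun g => vabs (f n g)).
  by apply: (vsimple_comp hmu); [exact: vabs0|exact: hf].
have int_ge0 n A : measurable A ->
    0 <= vintegral mul mu A (fun g => vabs (f n g)).
  by move=> mA; apply: (vintegral_ge0 hmul hmu) => // g _; exact: vabs_ge0.
have [heq1 [B [mB _ finB [y [yE y0]]]]] := heq.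
(* [y m] is the finite limit superior of the integrals over the complement of [B m], so each [m] can
   be treated separately. *)
apply: (climsup_squeeze0 l _ y) => // [n|m]; first exact: int_ge0.
have [E [u [mE muE supu u0]]] := hcvg _ (mB m) (finB m).
have mBE n : measurable (B m `&` E n) by exact: measurableI.
have mBD n : measurable (B m `\` E n) by exact: measurableD.
have abs_le n g : (B m `\` E n) g -> vabs (f n g) <= u n.
  move=> BEg; have [_ usup] := supu n.
  have BEn : [set vabs (f n g - 0) | g in B m `\` E n] (vabs (f n g)).
    by exists g; rewrite // subr0.
  by apply: (usup _).1; first exists (vabs (f n g)).
have u_ge0 n : 0 <= u n.
  have [u_empty _] := supu n.
  (* Over an empty set the supremum is 0 by convention; otherwise [u n] dominates some absolute
     value. *)
  have [/eqP BE0|/set0P[g BEg]] := boolP (B m `\` E n == set0).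
    by rewrite u_empty// BE0 image_set0.
  exact: le_trans (vabs_ge0 _) (abs_le _ _ BEg).
(* The measure of [B m] replaces that of [B m] minus [E n]: the product with [u n] tends to 0 by
   [pmul_lim0l], whose second factor is fixed. *)
pose b := ext_fine (mu (B m)).
have b0 : 0 <= b by exact: (fine_fam_ge0 hmu).
have mulu_ge0 n : 0 <= mul (u n) b by exact: (pmul_ge0 hmul).
have mCB : measurable (~` B m) by exact: measurableC.
rewrite -(yE m).
(* The two null terms are put back in front of the tail integral one at a time: first [mul (u n) b],
   then the integral over [B m] intersected with [E n], null by [heq1] because the measures of these
   sets tend to 0. *)
apply: ext_le_trans (climsup_add_null l _ _ mulu_ge0 (fun n => int_ge0 n _ mCB)
  (pmul_lim0l hmul b u0)).
apply: ext_le_trans (climsup_add_null l _ _ (fun n => int_ge0 n _ (mBE n)) _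
  (heq1 _ mBE muE)); last first.
  by move=> n; apply: vaddr_ge0 => //; exact: int_ge0.
apply: climsup_le => [n|n|]; first exact: int_ge0.
  by apply: vaddr_ge0; [|apply: vaddr_ge0 => //]; exact: int_ge0.
apply: nearW => n.
rewrite (vintegral_split hmul hmu (B m))// setTI setTD.
rewrite (vintegral_split hmul hmu (E n) (habs n) (mB m) (mE n)) addrA.
apply: vleD2r; apply: (vleD _ _ _ _ (lexx _)).
have fB : fin_measurable (mu := mu) (B m) by split.
apply: le_trans (vintegral_le_cst hmul hmu _ _ _ (habs n)
  (fin_measurableD hmu fB (mE n)) (abs_le n)) _.
apply: (pmul_le2l hmul) => //; rewrite /b (fine_fam_split hmu fB (mE n)).
rewrite -[leLHS]add0r; apply: vleD2r; exact: (fine_fam_ge0 hmu).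
Qed.
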